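(* Let $I$ and $J$ be (possibly infinite) sets and let $A=(a_{i,j})_{i\in I,\,j\in J}$ be a real $I\times J$ matrix that is tight. Then $A$ is loaded, i.e. there exists an injection $\phi: J\to I$ such that $a_{\phi(j),j}\neq 0$ for all $j\in J$.
   Context: $I$ and $J$ are arbitrary, possibly infinite (possibly uncountable) sets. $FS(J)$ denotes the set of vectors in $\mathbb{R}^J$ having finite support, and $RFS(I,J)$ denotes the set of real $I\times J$ matrices all of whose rows belong to $FS(J)$. For $A\in RFS(I,J)$ and any $\vec{x}\in\mathbb{R}^J$ (not necessarily of finite support) the product $A\vec{x}\in\mathbb{R}^I$ is well-defined, by $(A\vec{x})_i=\sum_{j\in J}a_{i,j}x_j$. A matrix $A\in RFS(I,J)$ is called tight if the only $\vec{x}\in\mathbb{R}^J$ with $A\vec{x}=\vec{0}$ is $\vec{x}=\vec{0}$. (Tightness thus includes the requirement $A\in RFS(I,J)$.) An $I\times J$ matrix $A=(a_{i,j})$ is called loaded if there exists an injection $\phi:J\to I$ such that $a_{\phi(j),j}\neq 0$ for all $j\in J$. *)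

(* Defs.v *)
From mathcomp Require Import all_boot all_order all_algebra.
From mathcomp Require Import boolp classical_sets functions cardinality fsbigop reals.

Set Implicit Arguments.
Unset Strict Implicit.
Unset Printing Implicit Defensive.

Import GRing.Theory.

Local Open Scope classical_set_scope.
Local Open Scope ring_scope.

Section LoadedMatrices.
Variables (R : realType) (I J : Type).

Definition FS (x : J -> R) : Prop := finite_set [set j | x j != 0].

Definition RFS (A : I -> J -> R) : Prop := forall i, FS (A i).

(* [{classic J}] is [J] with the choice structure that [\sum_(_ \in _)]
   requires.  That sum is the sum over the support of the summand when the
   support is finite, as it is for [A] in [RFS]; otherwise it is 0. *)
Definition mulmxv (A : I -> J -> R) (x : J -> R) : I -> R :=
  fun i => \sum_(j \in [set: {classic J}]) A i j * x j.

Definition tight (A : I -> J -> R) : Prop :=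
  RFS A /\ forall x : J -> R, mulmxv A x = (fun=> 0) -> x = (fun=> 0).

Definition loaded (A : I -> J -> R) : Prop :=
  exists phi : J -> I, injective phi /\ forall j, A (phi j) j != 0.

End LoadedMatrices.

(* Main.v *)
(* Tightness passes to suitable deletions.  If A is tight and j is a column, then
   by compactness of systems of linear equations with finite supports, finitely
   many rows force x_j = 0, so some row i with a_{i,j} <> 0 can be exchanged for
   the equation x_j = 0: the matrix without row i and column j is tight again.
   Iterating this omega times, and eventually matching every column met by a row
   already used, produces a matching whose rows are supported in its columns.
   Deleting such a closed matching always leaves a tight matrix, and closed
   matchings are stable under unions of chains, so Zorn's lemma gives a maximal
   one, and it covers all columns. *)
Require Import Defs.
From mathcomp Require Import all_boot all_order all_algebra.
From mathcomp Require Import boolp classical_sets functions cardinality fsbigop reals.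

Set Implicit Arguments.
Unset Strict Implicit.
Unset Printing Implicit Defensive.

Import GRing.Theory.

Local Open Scope classical_set_scope.
Local Open Scope ring_scope.

(** This supplies the chain condition of Zorn's lemma for properties tested on finite lists. The
    first alternative covers an empty chain [C]. *)
Lemma chain_seq_sub (T : eqType) (F : set T) (C : set (set T)) (l : seq T) :
  total_on C subset ->
  (forall x, x \in l -> (F `|` \bigcup_(M in C) M) x) ->
  (forall x, x \in l -> F x) \/
  exists2 M, C M & forall x, x \in l -> (F `|` M) x.
Proof.
move=> Ctot; elim: l => [_|x l IHl lFC]; first by left.
have FCx := lFC x (mem_head x l).
have {IHl} IHl : (forall y, y \in l -> F y) \/
    exists2 M, C M & forall y, y \in l -> (F `|` M) y.
  by apply: IHl => y yl; apply: lFC; rewrite inE yl orbT.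
case: FCx => [Fx|[N CN Nx]].
  case: IHl => [lF|[M CM lM]]; [left|right; exists M => //] => y;
    rewrite inE => /predU1P[->//|]; [exact: lF|by left|exact: lM].
right; case: IHl => [lF|[M CM lM]].
  exists N => // y; rewrite inE => /predU1P[->|/lF ?]; [by right|by left].
case: (Ctot _ _ CM CN) => [MN|NM]; [exists N => //|exists M => //] => y;
  by rewrite inE => /predU1P[->|/lM[Fy|My]]; [right; auto|left|right; auto].
Qed.

(** * Compactness of systems of finitary affine conditions *)

Section AffineCompactness.
Variables (K : fieldType) (J : Type).
Implicit Types (X : set (J -> K)) (F M : set (set (J -> K))).

Definition affine_set X :=
  forall (x y : J -> K) (t : K), X x -> X y -> X (fun k => x k + t * (y k - x k)).

Definition finitary_set X :=
  exists s : seq {classic J}, forall x y : J -> K, {in s, x =1 y} -> X x -> X y.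

(** The finite intersection property. *)
Definition finitely_solvable F :=
  forall l : seq (set (J -> K)), (forall X, X \in l -> F X) ->
  exists x : J -> K, forall X, X \in l -> X x.

Lemma affine_set_coord (k : J) (t : K) : affine_set [set x | x k = t].
Proof. by move=> x y u /= -> ->; rewrite subrr mulr0 addr0. Qed.

Lemma finitary_set_coord (k : J) (t : K) : finitary_set [set x | x k = t].
Proof.
by exists [:: k : {classic J}] => x y xy /= <-; rewrite (xy k) // mem_head.
Qed.

(* The values at [k] of the solutions of finitely many affine conditions form
   either a single point or all of [K]. *)
Lemma finitely_solvable_coord M (k : J) :
  (forall X, M X -> affine_set X) -> finitely_solvable M ->
  exists t, finitely_solvable (M `|` [set [set x | x k = t]]).
Proof.
move=> Maff Mfs.
have addE t (l : seq (set (J -> K))) :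
    (forall X, X \in l -> (M `|` [set [set x | x k = t]]) X) ->
    exists2 l' : seq (set (J -> K)), (forall X, X \in l' -> M X) &
      forall x, x k = t -> (forall X, X \in l' -> X x) ->
        forall X, X \in l -> X x.
  move=> lM; exists [seq X <- l | `[< M X >]].
    by move=> X; rewrite mem_filter => /andP[/asboolP].
  move=> x xk lx X Xl; case: (lM X Xl) => [MX|->//].
  by apply: lx; rewrite mem_filter Xl andbT; apply/asboolP.
(* Either [t = 0] is compatible with every finite subsystem, or some finite [l0] excludes the value
   0 at [k]. In the second case all solutions of [l0] agree at [k], and [t] is their common
   value. *)
have [M0|/existsNP[l0 /not_implyP[l0M nl0]]] := pselect
    (forall l : seq (set (J -> K)), (forall X, X \in l -> M X) ->
      exists2 x : J -> K, x k = 0 & forall X, X \in l -> X x).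
  exists 0 => l /addE[l' /M0[x xk l'x] ll']; exists x; exact: ll'.
have [x0 l0x0] := Mfs _ l0M; exists (x0 k) => l /addE[l' l'M ll'].
have [y l0l'y] : exists x : J -> K, forall X, X \in l0 ++ l' -> X x.
  by apply: Mfs => X; rewrite mem_cat => /orP[]; [exact: l0M|exact: l'M].
exists y; apply: ll'; last first.
  by move=> X Xl; apply: l0l'y; rewrite mem_cat Xl orbT.
apply: contrapT => /eqP yx; case: nl0.
(* If [x0] and [y] differed at [k], the line through them would contain this point, which solves
   [l0] and vanishes at [k]. *)
exists (fun j => x0 j + x0 k / (x0 k - y k) * (y j - x0 j)).
  rewrite -(opprB (x0 k)) mulrN mulfVK ?subrr //.
  by rewrite subr_eq0 eq_sym.
move=> X Xl0; apply: Maff; [exact: l0M|exact: l0x0|].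
by apply: l0l'y; rewrite mem_cat Xl0.
Qed.

(** Zorn's lemma gives a maximal family [M] of affine conditions whose union with [F] stays finitely
    solvable. By maximality [M] fixes the value at every [k], and these values form the solution. *)
Lemma affine_compactness F :
  (forall X, F X -> affine_set X) -> (forall X, F X -> finitary_set X) ->
  finitely_solvable F -> exists x, forall X, F X -> X x.
Proof.
move=> Faff Ffin Ffs.
pose P M := (forall X, M X -> affine_set X) /\ finitely_solvable (F `|` M).
have [C CP Ctot|M [[Maff Mfs] Mmax]] := @Zorn_bigcup _ P.
  split=> [X [M /CP[Maff _] /Maff//]|l lFC].
  have [lF|[M CM lM]] := chain_seq_sub Ctot lFC; first exact: Ffs.
  by have [_] := CP M CM; exact.
have FMaff X : (F `|` M) X -> affine_set X by case; [exact: Faff|exact: Maff].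
have Mcoord k : exists t, M [set x | x k = t].
  have [t tfs] := finitely_solvable_coord k FMaff Mfs.
  exists t; apply: contrapT => nMt.
  apply: (Mmax (M `|` [set [set x | x k = t]])).
    by split=> [X|/(_ _ (or_intror erefl))//]; left.
  split=> [X [/Maff//|->]|]; first exact: affine_set_coord.
  by rewrite setUA.
have [x Mx] := choice Mcoord.
exists x => X FX; have [s sX] := Ffin X FX.
(* The condition [X] sees only the coordinates in [s], so it passes to [x] from a solution [z] that
   agrees with [x] on [s]. *)
have [z Xsz] : exists z : J -> K,
    forall Y, Y \in X :: [seq [set z | z k = x k] | k : {classic J} <- s] -> Y z.
  apply: Mfs => Y; rewrite inE => /predU1P[->|/mapP[k _ ->]]; first by left.
  by right; exact: Mx.
apply: (sX z); last by apply: Xsz; rewrite mem_head.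
move=> k ks; apply: (Xsz [set z | z k = x k]); rewrite inE; apply/orP; right.
by apply/mapP; exists k.
Qed.

End AffineCompactness.

(** * Exchanging a row for a column *)

Section Exchange.
Variables (R : realType) (I J : Type).
Implicit Types (A : I -> J -> R) (x y : J -> R) (L : set I) (K : set J).

Lemma FS_seq (x : J -> R) : FS x ->
  exists2 s : seq {classic J}, uniq s & forall k : {classic J}, x k != 0 -> k \in s.
Proof.
move=> /(@finite_seqP {classic J})[s sE]; exists (undup s).
  exact: undup_uniq.
move=> k xk; rewrite mem_undup.
suff : [set` s] k by [].
by rewrite -sE.
Qed.

Lemma mulmxv_seq A i : FS (A i) ->
  exists s : seq {classic J},
    forall x, mulmxv A x i = \sum_(k <- s) A i k * x k.
Proof.
move=> /FS_seq[s s_uniq sA]; exists s => x.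
rewrite /mulmxv (fsbigE s) //; first by apply: eq_bigl => k; rewrite in_setT.
move=> k _ ks; have [->|/sA kin] := eqVneq (A i k) 0; first by rewrite mul0r.
by rewrite kin in ks.
Qed.

Lemma mulmxv_affine A x y (t : R) i : FS (A i) ->
  mulmxv A (fun k => x k + t * y k) i = mulmxv A x i + t * mulmxv A y i.
Proof.
move=> /mulmxv_seq[s sE]; rewrite !sE mulr_sumr -big_split /=.
by apply: eq_bigr => k _; rewrite mulrDr mulrCA.
Qed.

Lemma mulmxv_delta A i (j : {classic J}) :
  mulmxv A (fun k : {classic J} => (k == j)%:R) i = A i j.
Proof.
rewrite /mulmxv (fsbigE [:: j]) //=.
  by rewrite big_mkcond big_seq1 in_setT eqxx mulr1.
by move=> k _; rewrite inE => /negPf ->; rewrite mulr0.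
Qed.

(** Tightness after deletion of the rows in [L] and the columns in [K]. Vanishing on [K] stands for
    the deletion of columns, so the index types stay fixed. *)
Definition tight_off A L K := forall x,
  (forall k, K k -> x k = 0) -> (forall i, ~ L i -> mulmxv A x i = 0) ->
  x = (fun=> 0).

Lemma affine_set_row A i : FS (A i) -> affine_set [set x | mulmxv A x i = 0].
Proof.
move=> Ai x y t /= Ax Ay; rewrite mulmxv_affine //.
have -> : (fun k => y k - x k) = (fun k => y k + -1 * x k).
  by apply: funext => k; rewrite mulN1r.
by rewrite mulmxv_affine // Ax Ay !(mulr0, addr0).
Qed.

Lemma finitary_set_row A i : FS (A i) ->
  finitary_set [set x | mulmxv A x i = 0].
Proof.
move=> /mulmxv_seq[s sE]; exists s => x y xy /=; rewrite !sE; apply: etrans.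
by apply: eq_big_seq => k /xy ->.
Qed.

(* By compactness, finitely many of the remaining rows, together with those
   vanishing at [j], force [x j = 0]; in a shortest such list any row can be
   exchanged for [j]. *)
Lemma tight_off_exchange A L K (j : {classic J}) :
  RFS A -> tight_off A L K -> ~ K j ->
  exists i, [/\ ~ L i, A i j != 0 & tight_off A (i |` L) (j |` K)].
Proof.
move=> Arfs AT Kj.
(* With [x j = 1] added the system has no solution, so compactness yields an unsolvable finite part
   [l]. *)
pose F : set (set (J -> R)) := [set X |
  [\/ exists2 i, ~ L i & X = [set x | mulmxv A x i = 0],
      exists2 k, K k & X = [set x | x k = 0] | X = [set x | x j = 1]]].
have [l lF l0] : exists2 l : seq (set (J -> R)), (forall X, X \in l -> F X) &
    ~ exists x, forall X, X \in l -> X x.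
  apply: contrapT => nl.
  have [X|X||x Fx] := @affine_compactness R J F.
  - by move=> [[i _ ->]|[k _ ->]|->];
      [exact: affine_set_row|exact: affine_set_coord|exact: affine_set_coord].
  - move=> [[i _ ->]|[k _ ->]|->];
      [exact: finitary_set_row|exact: finitary_set_coord|].
    exact: finitary_set_coord.
  - by move=> l lF; apply: contrapT => l0; apply: nl; exists l.
  have x0 : x = (fun=> 0).
    apply: AT => [k Kk|i Li].
      by apply: (Fx [set x | x k = 0]); constructor 2; exists k.
    by apply: (Fx [set x | mulmxv A x i = 0]); constructor 1; exists i.
  have : x j = 1 by apply: (Fx [set x | x j = 1]); constructor 3.
  by rewrite x0 => /esym/eqP; rewrite oner_eq0.
(* These conditions, possibly infinitely many, can be imposed throughout because the unit vector at
   [j] meets them all. They force the row found below to have a nonzero entry at [j]. *)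
pose base x := [/\ forall k, K k -> x k = 0, x j = 1 &
  forall i, ~ L i -> A i j = 0 -> mulmxv A x i = 0].
have {}l0 : ~ exists2 x, base x & forall X, X \in l -> X x.
  by move=> [x _ lx]; apply: l0; exists x.
elim: l lF l0 => [_ []|X l IHl XlF Xl0].
  exists (fun k : {classic J} => (k == j)%:R) => //; split.
  - move=> k Kk; by case: eqP => // kj; case: Kj; rewrite -kj.
  - by rewrite eqxx.
  - by move=> i _ Aij; rewrite mulmxv_delta.
have lF Y : Y \in l -> F Y by move=> Yl; apply: XlF; rewrite inE Yl orbT.
(* If the tail is already unsolvable, induction applies. Otherwise a solution [x] of the tail
   violates [X], and since [base] settles the other kinds of condition, [X] is the equation of a row
   [i]. *)
have [[x [xK xj xb] lx]|] := pselect (exists2 x, base x &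
    forall X, X \in l -> X x); last exact: IHl.
have nXx : ~ X x.
  move=> Xx; apply: Xl0; exists x => // Y; rewrite inE => /predU1P[->//|].
  exact: lx.
have [[i Li XE]|[k Kk XE]|XE] := XlF X (mem_head X l); last 2 first.
- by case: nXx; rewrite XE; exact: xK.
- by case: nXx; rewrite XE.
have {nXx} Axi : mulmxv A x i != 0 by apply/eqP; rewrite XE in nXx.
have Aij : A i j != 0 by apply: contra_neq Axi; exact: xb.
exists i; split => // y yK yL.
have yLi i' : ~ L i' -> i' <> i -> mulmxv A y i' = 0.
  by move=> Li' i'i; apply: yL => -[].
have [Ayi|Ayi] := eqVneq (mulmxv A y i) 0.
  apply: AT => [k Kk|i' Li']; first by apply: yK; right.
  by have [->//|] := pselect (i' = i); exact: yLi.
(* Subtracting this multiple of [y] makes row [i] vanish. As [y] is zero at [j], on [K] and in the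
   other rows outside [L], all other conditions survive, a contradiction. *)
case: Xl0; exists (fun k => x k + - (mulmxv A x i / mulmxv A y i) * y k).
  split=> [k Kk||i' Li' Ai'j].
  - by rewrite xK // yK ?mulr0 ?addr0 //; right.
  - by rewrite xj yK ?mulr0 ?addr0 //; left.
  - rewrite mulmxv_affine // xb // (yLi i') ?mulr0 ?addr0 // => i'i.
    by move: Aij; rewrite -i'i Ai'j eqxx.
have zi : mulmxv A (fun k => x k + - (mulmxv A x i / mulmxv A y i) * y k) i = 0.
  by rewrite mulmxv_affine // mulNr divfK // subrr.
move=> Y; rewrite inE => /predU1P[->|Yl]; first by rewrite XE.
have := lx Y Yl; have [[i' Li' ->]|[k Kk ->]|->] := lF Y Yl => /= xY.
- have [->//|i'i] := pselect (i' = i).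
  by rewrite mulmxv_affine // xY (yLi i') // mulr0 addr0.
- by rewrite xY yK ?mulr0 ?addr0 //; right.
- by rewrite xY yK ?mulr0 ?addr0 //; left.
Qed.

End Exchange.

(** * Matchings and their closure *)

Section Matchings.
Variables (R : realType) (I J : Type) (A : I -> J -> R).
Implicit Types m : set (I * J).

Definition matched_rows m : set I := [set i | exists j, m (i, j)].
Definition matched_cols m : set J := [set j | exists i, m (i, j)].

Definition matching m := [/\ forall i j, m (i, j) -> A i j != 0,
  forall i i' j, m (i, j) -> m (i', j) -> i = i' &
  forall i j j', m (i, j) -> m (i, j') -> j = j'].

Definition extendable m :=
  matching m /\ tight_off A (matched_rows m) (matched_cols m).

Definition closed_matching m := matching m /\
  forall i k, matched_rows m i -> A i k != 0 -> matched_cols m k.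

Lemma matching_bigcup (C : set (set (I * J))) :
  total_on C subset -> (forall m, C m -> matching m) ->
  matching (\bigcup_(m in C) m).
Proof.
move=> Ctot Cm.
have C2 p q : (\bigcup_(m in C) m) p -> (\bigcup_(m in C) m) q ->
    exists2 m, C m & m p /\ m q.
  move=> [m mC mp] [m' m'C m'q].
  by case: (Ctot _ _ mC m'C) => mm; [exists m'|exists m] => //; split => //;
    apply: mm.
split=> [i j [m /Cm[+ _ _]]|i i' j mij mi'j|i j j' mij mij'].
- exact.
- have [m /Cm[_ inj _] [m1 m2]] := C2 _ _ mij mi'j; exact: inj m1 m2.
- have [m /Cm[_ _ inj] [m1 m2]] := C2 _ _ mij mij'; exact: inj m1 m2.
Qed.

(** A vector that vanishes on the matched columns is annihilated by every matched row, whose support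
    lies in those columns. *)
Lemma closed_matching_extendable m :
  tight A -> closed_matching m -> extendable m.
Proof.
move=> [Arfs AT] [mm mcl]; split=> // x xK xL; apply: AT; apply: funext => i.
have [mi|/xL//] := pselect (matched_rows m i).
rewrite /mulmxv fsbig1 // => k _.
have [->|/(mcl _ _ mi)/xK ->] := eqVneq (A i k) 0; first by rewrite mul0r.
by rewrite mulr0.
Qed.

Lemma extendable_add m (j : J) : RFS A -> extendable m -> ~ matched_cols m j ->
  exists i, extendable ((i, j) |` m).
Proof.
move=> Arfs [[mA mr mc] mT] mj.
have [i [mi Aij iT]] := tight_off_exchange Arfs mT mj.
exists i; split.
  split=> [i' j' [[-> ->]//|/mA//]|i' i'' j'|i' j' j''].
  - move=> [[-> ->]|m1] [[]|m2].
    + by move=> ->.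
    + by case: mj; exists i''.
    + by move=> _ j'j; case: mj; exists i'; rewrite -j'j.
    + exact: mr m1 m2.
  - move=> [[-> ->]|m1] [[]|m2].
    + by move=> ->.
    + by case: mi; exists j''.
    + by move=> i'i _; case: mi; exists j'; rewrite -i'i.
    + exact: mc m1 m2.
move=> x xK xL; apply: iT => [k [->|[i' mk]]|i' mi'].
- by apply: xK; exists i; left.
- by apply: xK; exists i'; right.
- apply: xL => -[k [[i'i _]|mk]]; apply: mi'; [by left|by right; exists k].
Qed.

(** One round of the closure: [q] lists the columns to match, and [q'] collects the supports of the
    finitely many rows added, to be covered in the next round. *)
Lemma extendable_cover m (q : seq {classic J}) : RFS A -> extendable m ->
  exists m' (q' : seq {classic J}), [/\ extendable m', m `<=` m',
    forall k : {classic J}, k \in q -> matched_cols m' k &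
    forall i (k : {classic J}), matched_rows m' i -> ~ matched_rows m i -> A i k != 0 ->
      k \in q'].
Proof.
move=> Arfs mE; elim: q => [|j q [m' [q' [m'E mm' m'q m'q']]]].
  by exists m, [::]; split.
have [m'j|m'j] := pselect (matched_cols m' j).
  exists m', q'; split=> // k; rewrite inE => /predU1P[->//|]; exact: m'q.
have [i iE] := extendable_add Arfs m'E m'j.
have [s _ sA] := FS_seq (Arfs i).
exists ((i, j : J) |` m'), (s ++ q'); split=> //.
- by move=> p /mm'; right.
- move=> k; rewrite inE => /predU1P[->|/m'q[i' m'k]].
    by exists i; left.
  by exists i'; right.
- move=> i' k [k' [[-> _]|m'k']] mi' Aik; rewrite mem_cat.
    by rewrite sA.
  by rewrite (m'q' i') ?orbT //; exists k'.
Qed.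

Lemma extendable_closure m (j : J) : RFS A -> extendable m ->
  closed_matching m ->
  exists2 m', closed_matching m' & m `<=` m' /\ matched_cols m' j.
Proof.
move=> Arfs mE [mm mcl].
(* A stage is a matching with a queue of columns: every column met by a matched row is matched or
   queued. Bundling this invariant lets [choice] produce a step function that can be iterated. *)
pose St := {p : set (I * J) * seq {classic J} | extendable p.1 /\
  forall i k, matched_rows p.1 i -> A i k != 0 ->
    matched_cols p.1 k \/ k \in p.2}.
have St0 : extendable m /\ forall i k, matched_rows m i -> A i k != 0 ->
    matched_cols m k \/ k \in [:: j : {classic J}].
  by split=> // i k mi Aik; left; exact: mcl mi Aik.
have next (p : St) : exists p' : St, (sval p).1 `<=` (sval p').1 /\
    forall k, k \in (sval p).2 -> matched_cols (sval p').1 k.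
  case: p => -[m1 q1] /= [m1E m1q].
  have [m2 [q2 [m2E m12 q1m2 m2q]]] := extendable_cover q1 Arfs m1E.
  have Hst : extendable m2 /\ forall i k, matched_rows m2 i -> A i k != 0 ->
      matched_cols m2 k \/ k \in q2.
    split=> // i k m2i Aik.
    have [m1i|m1i] := pselect (matched_rows m1 i); last by right; exact: m2q Aik.
    left; have [[i' m1k]|/q1m2//] := m1q i k m1i Aik.
    by exists i'; exact: m12.
  by exists (exist _ (m2, q2) Hst).
have [f fP] := choice next.
pose u n := sval (iter n f (exist _ (m, [:: j : {classic J}]) St0)).
have uS n : (u n).1 `<=` (u n.+1).1 by exact: (fP _).1.
have uq n k : k \in (u n).2 -> matched_cols (u n.+1).1 k by exact: (fP _).2.
have ule n n' : (n <= n')%N -> (u n).1 `<=` (u n').1.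
  move=> /subnK <-; elim: (n' - n)%N => [//|d IHd].
  exact: subset_trans IHd (uS _).
have uP n : extendable (u n).1 /\ forall i k, matched_rows (u n).1 i ->
    A i k != 0 -> matched_cols (u n).1 k \/ k \in (u n).2.
  exact: (svalP (iter n f _)).
(* A column met by a row of stage [n] is matched by stage [n.+1], so the union is closed. The
   initial queue contains [j], hence stage 1 matches [j]. *)
exists (\bigcup_(M in range (fun n => (u n).1)) M).
  split.
    apply: matching_bigcup => [_ _ [n _ <-] [n' _ <-]|_ [n _ <-]].
      by case: (leqP n n') => [/ule|/ltnW/ule]; [left|right].
    by have [[]] := uP n.
  move=> i k [j' [_ [n _ <-] unij]] Aik.
  have [[i' uk]|/uq[i' uk]] := (uP n).2 i k (ex_intro _ j' unij) Aik.
    by exists i', (u n).1 => //; exists n.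
  by exists i', (u n.+1).1 => //; exists n.+1.
split=> [p mp|]; first by exists m => //; exists 0%N.
have [i uij] : matched_cols (u 1%N).1 j by apply: uq; rewrite mem_head.
by exists i, (u 1%N).1 => //; exists 1%N.
Qed.

End Matchings.

Theorem theorem1p4 (R : realType) (I J : Type) (A : I -> J -> R) :
  tight A -> loaded A.
Proof.
move=> At.
have [C CP Ctot|m [[mm mcl] mmax]] := @Zorn_bigcup _ (closed_matching A).
  split; first by apply: matching_bigcup => // m /CP[].
  move=> i k [j [m Cm mij]] Aik.
  have [i' mk] := (CP m Cm).2 i k (ex_intro _ j mij) Aik.
  by exists i', m.
have mfull j : exists i, m (i, j).
  apply: contrapT => mj.
  have [m' m'cl [mm' m'j]] := extendable_closure j At.1
    (closed_matching_extendable At (conj mm mcl)) (conj mm mcl).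
  apply: (mmax m') => //; split=> // m'm; apply: mj.
  by case: m'j => i /m'm; exists i.
have [phi mphi] := choice mfull; case: mm => mA _ mc.
(* Injectivity holds because a row is matched to only one column. *)
exists phi; split=> [j j' jj'|j].
  by apply: mc (mphi j) _; rewrite jj'.
exact: mA.
Qed.
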